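(* Let $k\geq 3$ be an integer and let $G$ be a finite simple graph. If $$\sum_{0\leq j\leq k-1} c_{2j+1}(G-X)\leq \frac{5}{6k^{2}}|X| \quad\text{for all } X\subseteq V(G),$$ then $G$ has a $\{P_{2},P_{2k+1}\}$-factor.
   Context: For a graph $H$ and an integer $j\geq 1$, $c_{j}(H)$ denotes the number of connected components of $H$ having exactly $j$ vertices. $P_n$ denotes the path on $n$ vertices. For a set $\mathcal{F}$ of connected graphs, an $\mathcal{F}$-factor of $G$ is a spanning subgraph of $G$ each of whose components is isomorphic to a member of $\mathcal{F}$. *)

(* Defs.v *)
From HB Require Import structures.
From mathcomp Require Import all_boot all_order all_algebra.
Set Implicit Arguments. Unset Strict Implicit. Unset Printing Implicit Defensive.

Definition simple_graph (T : finType) (e : rel T) : Prop :=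
  symmetric e /\ irreflexive e.

Definition induced (T : finType) (e : rel T) (S : {set T}) : rel T :=
  fun x y => [&& x \in S, y \in S & e x y].

Definition is_component (T : finType) (e : rel T) (S : {set T}) (C : {set T}) : bool :=
  [exists x in S, C == [set y in S | connect (induced e S) x y]].

Definition comp_count (T : finType) (e : rel T) (S : {set T}) (j : nat) : nat :=
  #|[set C : {set T} | is_component e S C && (#|C| == j)]|.

Definition c_del (T : finType) (e : rel T) (X : {set T}) (j : nat) : nat :=
  comp_count e (~: X) j.

Definition induces_path (T : finType) (H : rel T) (C : {set T}) (n : nat) : Prop :=
  exists f : 'I_n -> T,
    injective f /\ (forall x, x \in C <-> exists i, f i = x) /\
    (forall i j : 'I_n, H (f i) (f j) = ((i.+1 == j :> nat) || (j.+1 == i :> nat))).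

Definition has_P2_Pm_factor (T : finType) (e : rel T) (m : nat) : Prop :=
  exists H : rel T,
    symmetric H /\ (forall x y, H x y -> e x y) /\
    (forall C : {set T}, is_component H setT C ->
        induces_path H C 2 \/ induces_path H C m).

(* Main.v *)
Require Import Defs.
From HB Require Import structures.
From mathcomp Require Import all_boot all_order all_algebra zify.
Import Order.TTheory GRing.Theory Num.Theory.
Set Implicit Arguments. Unset Strict Implicit. Unset Printing Implicit Defensive.

(** Only the isolated vertices of [G - X] matter: the hypothesis says that an
    independent set [I] has at least [6 k^2 / 5 * #|I|] neighbours.

    As in the Gallai-Edmonds theorem, [V(G)] splits into a set [A] and pairwise
    non-adjacent factor-critical blocks such that [A] satisfies Hall's condition
    towards the blocks. If every block without a {P_2, P_2k+1}-factor can be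
    matched into [A] as well, then some matching covers [A] together with all
    these bad blocks, and the factor is assembled block by block. To check
    Hall's condition for bad blocks it suffices that each bad block [D] contains
    an independent set [I] with [5 (#|D| - #|I| + 1) <= 6 k^2 #|I|].

    Let [M] be a perfect matching of [D - v]. A path from [v] alternating through
    [k] edges of [M] would give a factor of [D], so all alternating paths from [v]
    are shorter. Since [D] is factor-critical, every vertex is reached by such a
    path, and it follows that any [M]-alternating path in [D - v] has at most
    [k (k - 1)] matching edges. The two ends of a maximal one have all their
    neighbours on it, and they are non-adjacent if it has at least [k] matching
    edges, so picking ends greedily yields [I] with [#|D| - 1 <= k (k - 1) #|I|]. *)

(** * Hall's theorem and a two-sided matching lemma *)

Section Hall.
Variables A B : finType.

Definition hall_condition (D : {set A}) (S : A -> {set B}) :=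
  forall J : {set A}, J \subset D -> #|J| <= #|\bigcup_(a in J) S a|.

(* Rado's argument: a Hall family with a member [S a] containing [x != y] stays
   Hall after deleting [x] or [y] from [S a], by submodularity of the union. *)
Lemma hall_condition_remove D S a x y : hall_condition D S -> a \in D ->
    x \in S a -> y \in S a -> x != y ->
    exists2 z, z \in S a & hall_condition D (fun b => if b == a then S a :\ z else S b).
Proof.
move=> hS aD xS yS xy.
pose rem z b := if b == a then S a :\ z else S b.
have violator z : z \in S a -> (hall_condition D (rem z)) \/
    exists J : {set A}, [/\ J \subset D, a \notin J &
      #|(\bigcup_(b in J) S b) :|: (S a :\ z)| <= #|J|].
  move=> zS.
  case: (boolP [forall J : {set A}, (J \subset D) ==>
      (#|J| <= #|\bigcup_(b in J) rem z b|)]) => [/forallP h|].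
    by left=> J JD; move: (h J); rewrite JD.
  rewrite negb_forall => /existsP [J]; rewrite negb_imply -ltnNge => /andP[JD lt].
  have eqrem (K : {set A}) : a \notin K ->
      \bigcup_(b in K) rem z b = \bigcup_(b in K) S b.
    move=> aK; apply: eq_bigr => b bK; rewrite /rem ifF //.
    by apply: contraNF aK => /eqP <-.
  have aJ : a \in J.
    apply: contraLR lt => aJ; rewrite -leqNgt (eqrem _ aJ); exact: hS.
  right; exists (J :\ a); split; first exact: subset_trans (subsetDl _ _) JD.
    by rewrite !inE eqxx.
  move: lt; rewrite (big_setD1 a) //= eqrem ?inE ?eqxx // [rem z a]/rem eqxx.
  by rewrite (cardsD1 a J) aJ add1n ltnS setUC.
case: (violator x xS) => [h|[J1 [J1D aJ1 le1]]]; first by exists x.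
case: (violator y yS) => [h|[J2 [J2D aJ2 le2]]]; first by exists y.
exfalso.
set U1 := _ :|: _ in le1; set U2 := _ :|: _ in le2.
(* As [x] and [y] differ, [S a :\ x] and [S a :\ y] together cover [S a], so the union of the two
   violators may be enlarged by [a]. *)
have hU : #|J1 :|: J2|.+1 <= #|U1 :|: U2|.
  have -> : #|J1 :|: J2|.+1 = #|a |: (J1 :|: J2)|.
    by rewrite cardsU1 inE negb_or aJ1 aJ2.
  apply: leq_trans (hS _ _) _.
    by rewrite !subUset J1D J2D sub1set aD.
  apply: subset_leq_card; apply/bigcupsP => b; rewrite !inE => /or3P[/eqP->|b1|b2].
  - apply/subsetP => z zS; rewrite /U1 /U2 !inE zS.
    case: (eqVneq z x) => [->|_] /=; first by rewrite xy !orbT.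
    by rewrite !orbT.
  - apply/subsetP => z zS; rewrite inE [z \in U1]inE; apply/orP; left; apply/orP; left.
    by apply/bigcupP; exists b.
  - apply/subsetP => z zS; rewrite inE orbC [z \in U2]inE; apply/orP; left; apply/orP; left.
    by apply/bigcupP; exists b.
have hI : #|J1 :&: J2| <= #|U1 :&: U2|.
  apply: leq_trans (hS _ _) _; first by rewrite subIset ?J1D.
  apply: subset_leq_card; apply/bigcupsP => b; rewrite inE => /andP[b1 b2].
  apply/subsetP => z zS; rewrite !inE; apply/andP; split; apply/orP; left;
    by apply/bigcupP; exists b.
have := cardsUI J1 J2; have := cardsUI U1 U2; lia.
Qed.

(** Induct on the total size of the [S a]. Deletions lead to singletons, which are distinct by
    Hall's condition for pairs. Values lie in [option B] because [B] may be empty. *)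
Lemma hall D S : hall_condition D S ->
  exists f : A -> option B, {in D &, injective f} /\
    (forall a, a \in D -> exists2 b, f a = Some b & b \in S a).
Proof.
have [n] := ubnP (\sum_(a in D) #|S a|); elim: n S => // n IHn S ltn hS.
case: (boolP [exists a in D, 1 < #|S a|]) => [/existsP[a /andP[aD]]|].
  case/card_gt1P => x [y [xS yS xy]].
  have [z zS hz] := hall_condition_remove hS aD xS yS xy.
  have [|f [finj fS]] := IHn _ _ hz.
    move: ltn; rewrite (bigD1 a) //= (cardsD1 z (S a)) zS add1n addSn ltnS.
    rewrite [X in _ -> X < _](bigD1 a) //= eqxx; apply: leq_trans.
    by rewrite ltnS leq_add2l; apply: leq_sum => b /andP[_ /negPf ->].
  exists f; split=> // b bD; have [c -> cS] := fS b bD; exists c => //.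
  by move: cS; case: eqP => [->|//]; rewrite inE => /andP[].
rewrite negb_exists => /forallP h1.
have c1 a : a \in D -> exists x, S a = [set x].
  move=> aD; apply/cards1P; move: (h1 a); rewrite aD /= -leqNgt eqn_leq => ->.
  by have := hS [set a]; rewrite sub1set aD cards1 big_set1 => ->.
have pickS a : a \in D -> exists2 b, [pick x in S a] = Some b & S a = [set b].
  move=> aD; have [x Sx] := c1 a aD; exists x => //; rewrite Sx.
  by case: pickP => [y /set1P->|/(_ x)]; rewrite // inE eqxx.
exists (fun a => [pick x in S a]); split=> [a b aD bD|a aD]; last first.
  by have [x -> ->] := pickS a aD; exists x; rewrite ?inE.
have [x -> Sx] := pickS a aD; have [y -> Sy] := pickS b bD => -[xy].
apply/eqP; apply: contraT => ab.
have := hS [set a; b]; rewrite subUset !sub1set aD bD cards2 ab => /(_ isT).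
by rewrite bigcup_setU !big_set1 Sx Sy xy setUid cards1.
Qed.

End Hall.

(** Apply the hypothesis to the members of [X] unrelated to [J]: their partners all lie in
    [D :\: J]. *)
Lemma hall_dual (A B : finType) (D J : {set A}) (X : {set B}) (r : A -> B -> bool) :
  (forall Y : {set B}, Y \subset X ->
     #|Y| <= #|[set d in D | [exists x in Y, r d x]]|) ->
  J \subset D -> #|J| + #|X| <= #|[set x in X | [exists d in J, r d x]]| + #|D|.
Proof.
move=> hX JD; set N := [set x in X | _].
have := hX (X :\: N) (subsetDl _ _).
have : #|[set d in D | [exists x in X :\: N, r d x]]| <= #|D :\: J|.
  apply: subset_leq_card; apply/subsetP => c; rewrite !inE.
  case/andP=> -> /existsP[x /andP[]]; rewrite !inE => /andP[nN xX] rcx.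
  rewrite andbT; apply: contra nN => cJ; rewrite xX.
  by apply/existsP; exists c; rewrite cJ.
have NX : N \subset X by apply/subsetP => x; rewrite inE => /andP[].
rewrite !cardsD (setIidPr NX) (setIidPr JD).
by have := subset_leq_card NX; have := subset_leq_card JD; lia.
Qed.

(* Apply [hall] with [#|D| - #|X|] dummy partners available to the members of
   [D :\: Bad]; the resulting injection is then onto. *)
Lemma matching_covering_both (A B : finType) (D Bad : {set A}) (X : {set B})
    (r : A -> B -> bool) :
  (forall Y : {set B}, Y \subset X ->
     #|Y| <= #|[set d in D | [exists x in Y, r d x]]|) ->
  (forall J : {set A}, J \subset D -> J \subset Bad ->
     #|J| <= #|[set x in X | [exists d in J, r d x]]|) ->
  exists g : A -> option B,
    [/\ forall d x, d \in D -> g d = Some x -> x \in X /\ r d x,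
        forall d, d \in D -> d \in Bad -> g d <> None,
        forall d d' x, d \in D -> d' \in D -> g d = Some x -> g d' = Some x -> d = d'
      & forall x, x \in X -> exists2 d, d \in D & g d = Some x].
Proof.
move=> hX hBad; pose n := #|D| - #|X|.
have leXD : #|X| <= #|D|.
  apply: leq_trans (hX X (subxx _)) _; apply: subset_leq_card.
  by apply/subsetP => d; rewrite inE => /andP[].
pose S d : {set B + 'I_n} :=
  [set w | match w with inl x => (x \in X) && r d x | inr _ => d \notin Bad end].
have card_sum (Y : {set B}) (I : {set 'I_n}) : #|inl @: Y :|: inr @: I| = #|Y| + #|I|.
  rewrite cardsU !card_imset; [|by move=> ? ? []..].
  rewrite (_ : _ :&: _ = set0) ?cards0 ?subn0 //; apply/setP => w; rewrite !inE.
  by apply: contraTF isT => /andP[/imsetP[x _ ->] /imsetP[]].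
have [J JD|f [finj fS]] := @hall A _ D S.
  set N := [set x in X | [exists d in J, r d x]].
  have subN : inl @: N \subset \bigcup_(d in J) S d.
    apply/subsetP => w /imsetP[x]; rewrite inE => /andP[xX /existsP[d /andP[dJ rdx]]] ->.
    by apply/bigcupP; exists d; rewrite // inE xX.
  have [JB|/subsetPn[d dJ dB]] := boolP (J \subset Bad).
    apply: leq_trans (hBad J JD JB) _.
    by apply: leq_trans (subset_leq_card subN); rewrite card_imset // => ? ? [].
  (* A member of [J] outside [Bad] brings in all the dummies, and [hall_dual] bounds [#|J|] by
     [#|N| + n]. *)
  have : #|N| + #|[set: 'I_n]| <= #|\bigcup_(d in J) S d|.
    rewrite -card_sum; apply: subset_leq_card; rewrite subUset subN /=.
    by apply/subsetP => w /imsetP[i _ ->]; apply/bigcupP; exists d; rewrite // inE.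
  apply: leq_trans; rewrite cardsT card_ord.
  by have := hall_dual hX JD; rewrite -/N /n; lia.
pose g d := if f d is Some (inl x) then Some x else None.
have gf d x : g d = Some x -> f d = Some (inl x).
  by rewrite /g; case: (f d) => [[y|]|] // [->].
exists g; split=> [d x dD /gf fd|d dD dB|d d' x dD d'D /gf fd /gf fd'|x xX].
- have [w] := fS d dD; rewrite fd => -[<-]; rewrite inE => /andP[-> ->]; by [].
- have [w] := fS d dD; rewrite /g => ->; rewrite inE; case: w => // i.
  by rewrite dB.
- by apply: finj => //; rewrite fd fd'.
have fD : f @: D = Some @: (inl @: X :|: inr @: [set: 'I_n]).
  apply/eqP; rewrite eqEcard; apply/andP; split; last first.
    rewrite (@card_imset _ _ Some); last by move=> ? ? [].
    by rewrite card_sum card_in_imset // cardsT card_ord /n; lia.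
  apply/subsetP => w /imsetP[d dD ->]; have [c -> ] := fS d dD.
  rewrite inE => cS; apply/imsetP; exists c => //; rewrite inE.
  by case: c cS => [y /andP[yX _]|i _]; rewrite imset_f ?orbT.
have : Some (inl x) \in f @: D by rewrite fD; apply: imset_f; rewrite inE imset_f.
case/imsetP=> d dD fd.
by exists d; rewrite // /g -fd.
Qed.

(** * Matchings and decompositions into odd blocks *)

Lemma partitionU (T : finType) (P Q : {set {set T}}) (S R : {set T}) :
  partition P S -> partition Q R -> [disjoint S & R] ->
  partition (P :|: Q) (S :|: R) /\ #|P :|: Q| = #|P| + #|Q|.
Proof.
move=> pP pQ dis; case/and3P: (pP) => /eqP cP tP P0; case/and3P: (pQ) => /eqP cQ tQ Q0.
split; last first.
  rewrite cardsU (_ : P :&: Q = set0) ?cards0 ?subn0 //; apply/setP => B; rewrite !inE.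
  apply: contraNF P0 => /andP[BP BQ]; suff <- : B = set0 by [].
  apply/eqP; rewrite -subset0 -(eqP (_ : S :&: R == set0)) ?setI_eq0 //.
  by rewrite subsetI (partitionS pP BP) (partitionS pQ BQ).
apply/and3P; split.
- by rewrite -cP -cQ /cover bigcup_setU.
- by apply: trivIsetU; rewrite // cP cQ.
- by rewrite inE negb_or P0.
Qed.

Section Graph.
Variables (T : finType) (e : rel T).
Hypotheses (e_sym : symmetric e) (e_irr : irreflexive e).

(** The partner map is total and fixes everything outside [S], so matchings of disjoint sets combine
    by composition. *)
Definition perfect_matching (S : {set T}) (nu : T -> T) : Prop :=
  [/\ involutive nu,
      forall x, x \in S -> nu x \in S /\ e x (nu x)
    & forall x, x \notin S -> nu x = x].

Definition matchable (S : {set T}) : Prop := exists nu, perfect_matching S nu.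

Definition factor_critical (D : {set T}) : Prop :=
  forall u, u \in D -> matchable (D :\ u).

Lemma matchable0 : matchable set0.
Proof. by exists id; split=> // x; rewrite inE. Qed.

Lemma matchable2 x y : e x y -> matchable [set x; y].
Proof.
move=> exy; have xy : x != y by apply: contraTneq exy => ->; rewrite e_irr.
exists (fun z => if z == x then y else if z == y then x else z); split=> z /=.
- case: (eqVneq z x) => [->|zx]; first by rewrite eqxx (negPf (_ : y != x)) // eq_sym.
  by case: (eqVneq z y) => [->|zy]; rewrite ?eqxx // (negPf zx) (negPf zy).
- rewrite !inE => /orP[] /eqP ->; rewrite ?eqxx ?orbT //=.
  by rewrite (negPf (_ : y != x)) ?eqxx // 1?e_sym // eq_sym.
- by rewrite !inE negb_or => /andP[/negPf -> /negPf ->].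
Qed.

Lemma matchableU (S R : {set T}) : [disjoint S & R] ->
  matchable S -> matchable R -> matchable (S :|: R).
Proof.
move=> dis [nu [nuK nuS nu0]] [mu [muK muR mu0]].
have inS x : x \in S -> mu x = x by move=> xS; apply: mu0; rewrite (disjointFr dis).
have inR x : x \in R -> nu x = x by move=> xR; apply: nu0; rewrite (disjointFl dis).
exists (nu \o mu); split=> x /=.
- have [xR|xR] := boolP (x \in R).
    by rewrite (inR (mu x)) ?muK ?(inR x) //; case: (muR x).
  rewrite (mu0 x) //; have [xS|xS] := boolP (x \in S).
    by rewrite inS ?nuK //; case: (nuS x).
  by rewrite !(nu0, mu0).
- rewrite !inE => /orP[] xX.
    by rewrite inS //; case: (nuS x xX) => -> ->.
  by case: (muR x xX) => h1 h2; rewrite inR // h1 orbT.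
- by rewrite inE negb_or => /andP[xS xR]; rewrite mu0 // nu0.
Qed.

(** Boolean, so that a maximal one can be chosen by [arg_maxnP]. Blocks are unions of components of
    the graph on [W :\: A] and need not be connected. *)
Definition decomposition (W A : {set T}) (P : {set {set T}}) : bool :=
  [&& A \subset W, partition P (W :\: A), [forall D in P, odd #|D|]
    & [forall D in P, forall D' in P, forall x in D, forall y in D',
        e x y ==> (D == D')]].

Lemma decompositionP (W A : {set T}) (P : {set {set T}}) : reflect
  [/\ A \subset W, partition P (W :\: A), forall D, D \in P -> odd #|D|
    & forall D D' x y, D \in P -> D' \in P -> x \in D -> y \in D' -> e x y -> D = D']
  (decomposition W A P).
Proof.
apply: (iffP and4P) => -[h1 h2 h3 h4]; split=> //.
- by move=> D DP; move/forallP/(_ D): h3; rewrite DP.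
- move=> D D' x y DP D'P xD yD' exy.
  move/forall_inP/(_ D DP)/forall_inP/(_ D' D'P): h4.
  by move/forall_inP/(_ x xD)/forall_inP/(_ y yD'); rewrite exy => /eqP.
- exact/forall_inP.
- apply/forall_inP => D DP; apply/forall_inP => D' D'P; apply/forall_inP => x xD.
  apply/forall_inP => y yD'; apply/implyP => exy; apply/eqP; exact: h4 exy.
Qed.

Definition touches (D : {set T}) (a : T) : bool := [exists x in D, e x a].

Definition hall_into (A : {set T}) (P : {set {set T}}) : Prop :=
  forall Y : {set T}, Y \subset A ->
    #|Y| <= #|[set D in P | [exists a in Y, touches D a]]|.

Lemma union_closed_bigcup (Q : {set T} -> Prop) (I : finType) (J : {set I})
    (F : I -> {set T}) :
  Q set0 -> (forall S R : {set T}, [disjoint S & R] -> Q S -> Q R -> Q (S :|: R)) ->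
  (forall i, i \in J -> Q (F i)) ->
  (forall i j x, i \in J -> j \in J -> x \in F i -> x \in F j -> i = j) ->
  Q (\bigcup_(i in J) F i).
Proof.
move=> Q0 QU; have [n] := ubnP #|J|; elim: n J => // n IHn J ltn QF inj.
have [->|[i iJ]] := set_0Vmem J; first by rewrite big_set0.
rewrite (big_setD1 i) //=; apply: QU; [|exact: QF|apply: IHn].
- rewrite -setI_eq0; apply/eqP/setP => x; rewrite !inE; apply: contraTF isT.
  case/andP=> xi /bigcupP[j]; rewrite !inE => /andP[ji jJ] xj.
  by rewrite (inj i j x) ?eqxx in ji.
- by move: ltn; rewrite (cardsD1 i) iJ.
- by move=> j /setD1P[_]; apply: QF.
- by move=> j j' x /setD1P[_ jJ] /setD1P[_ j'J]; apply: inj.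
Qed.

(** [Q] is arbitrary because the lemma serves both [matchable] and [tiled]. Some matching of blocks
    into [A] covers [A] and the bad blocks; a block matched to [a] is united with [a], and an
    unmatched block satisfies [Q] itself. *)
Lemma decomposition_assemble (Q : {set T} -> Prop) (W A : {set T}) (P Bad : {set {set T}}) :
  Q set0 -> (forall S R : {set T}, [disjoint S & R] -> Q S -> Q R -> Q (S :|: R)) ->
  (forall x y, e x y -> Q [set x; y]) ->
  decomposition W A P -> hall_into A P ->
  (forall D x, D \in P -> x \in D -> Q (D :\ x)) ->
  (forall D, D \in P -> D \notin Bad -> Q D) ->
  (forall J : {set {set T}}, J \subset P -> J \subset Bad ->
     #|J| <= #|[set a in A | [exists D in J, touches D a]]|) ->
  Q W.
Proof.
move=> Q0 QU Q2 /decompositionP[AW partP oddP sepP] hA Qcrit Qgood hBad.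
have [g [gr gBad ginj gsurj]] := matching_covering_both hA hBad.
pose F D := D :|: (if g D is Some a then [set a] else set0).
have DWA D : D \in P -> D \subset W :\: A by apply: partitionS.
have gA D a : D \in P -> g D = Some a -> a \in A by move=> DP /(gr _ _ DP)[].
have notA D x : D \in P -> x \in D -> x \notin A.
  by move=> /DWA/subsetP DW /DW; rewrite inE => /andP[].
have -> : W = \bigcup_(D in P) F D.
  apply/setP => x; apply/idP/bigcupP => [xW|[D DP]].
    have [xA|xA] := boolP (x \in A).
      by have [D DP gD] := gsurj x xA; exists D; rewrite // /F gD !inE eqxx orbT.
    have : x \in cover P by rewrite (cover_partition partP) inE xA.
    by case/bigcupP=> D DP xD; exists D; rewrite // inE xD.
  rewrite inE => /orP[xD|]; first by move/subsetP/(_ x xD): (DWA D DP); rewrite inE => /andP[].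
  case gD: (g D) => [a|]; rewrite inE // => /eqP->.
  exact: (subsetP AW) (gA D a DP gD).
apply: union_closed_bigcup => //.
  move=> D DP; rewrite /F; case gD: (g D) => [a|]; last first.
    by rewrite setU0; apply: Qgood => //; apply: contraPN gD => /(gBad D DP).
  have [aA /existsP[x /andP[xD exa]]] := gr D a DP gD.
  have aD : a \notin D by apply: contraL aA; apply: notA.
  (* Spend the edge from [x] to [a]; what remains of the block is [D :\ x]. *)
  have -> : D :|: [set a] = (D :\ x) :|: [set x; a].
    apply/setP => y; rewrite !inE; case: (eqVneq y x) => [->|//]; by rewrite xD.
  apply: QU; [|exact: Qcrit|exact: Q2].
  rewrite -setI_eq0; apply/eqP/setP => y; rewrite !inE.
  case: (eqVneq y x) => //= _; case: (eqVneq y a) => [->|_]; last by rewrite andbF.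
  by rewrite (negPf aD).
move=> D D' x DP D'P; rewrite !inE => /orP[xD|xD] /orP[xD'|xD'].
- apply/eqP; apply: contraT => DD'.
  have := trivIsetP (partition_trivIset partP) D D' DP D'P DD'.
  by move=> /disjointFr/(_ xD); rewrite xD'.
- case gD': (g D') xD' => [a|]; rewrite inE // => /eqP xa.
  by move: (notA D x DP xD); rewrite xa (gA D' a).
- case gD: (g D) xD => [a|]; rewrite inE // => /eqP xa.
  by move: (notA D' x D'P xD'); rewrite xa (gA D a).
- case gD: (g D) xD => [a|]; rewrite inE // => /eqP xa.
  case gD': (g D') xD' => [a'|]; rewrite inE // => /eqP xa'.
  by apply: (ginj D D' x) => //; rewrite ?xa // gD' -xa' xa.
Qed.
End Graph.

(** * Decompositions with factor-critical blocks *)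

Section CriticalDecomposition.
Variables (T : finType) (e : rel T).
Hypotheses (e_sym : symmetric e) (e_irr : irreflexive e).

Lemma odd_decomposition (W A : {set T}) (P : {set {set T}}) :
  decomposition e W A P -> odd #|W| = odd (#|A| + #|P|).
Proof.
case/decompositionP=> AW partP oddP _.
rewrite -(cardsID A W) (setIidPr AW) (card_partition partP) !oddD; congr (_ (+) _).
rewrite -sum1_card; apply: (big_ind2 (fun a b => odd a = odd b)) => // a b c d.
by rewrite !oddD => -> ->.
Qed.

(** The difference [#|P| - #|A|] is maximized first, then [#|A|]. Comparisons of differences are
    written additively since subtraction truncates. *)
Lemma maximal_decomposition (W : {set T}) :
  exists (A : {set T}) (P : {set {set T}}), decomposition e W A P /\
    forall A' P', decomposition e W A' P' -> #|P| + #|A'| <= #|P'| + #|A| ->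
      #|A'| <= #|A| /\ #|P| + #|A'| = #|P'| + #|A|.
Proof.
(* A lexicographic weight: the difference is shifted by [#|T|] to stay nonnegative, and [#|A|] is
   less than the factor [#|T|.+1]. *)
pose w (i : {set T} * {set {set T}}) := (#|i.2| + #|T| - #|i.1|) * #|T|.+1 + #|i.1|.
pose i0 : {set T} * {set {set T}} := (W, set0).
have d0 : decomposition e W i0.1 i0.2.
  apply/decompositionP; split=> //= [|D|D ? ? ?]; rewrite ?inE //.
  by rewrite setDv partition_set0.
case: (arg_maxnP w d0 (P := fun i => decomposition e W i.1 i.2)) => -[A P] /= dAP mx.
exists A, P; split=> // A' P' d' le; have := mx (A', P') d'; rewrite /w /=.
have := max_card A; have := max_card A'; move: #|T| #|P| #|P'| le => t p p' le at' at_ mw.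
have leq' : p' + t - #|A'| <= p + t - #|A|.
  rewrite leqNgt; apply/negP => lt; have := leq_mul lt (leqnn t.+1); rewrite mulSn; lia.
have eqq : p' + t - #|A'| = p + t - #|A| by lia.
by move: mw; rewrite eqq leq_add2l; lia.
Qed.

(** When [#|P| = #|A|], [hall_dual] turns Hall's condition for [A] into that for the blocks, so all
    of [P] may be declared bad and every block gets a partner. *)
Lemma perfectly_matched_decomposition (W A : {set T}) (P : {set {set T}}) :
  decomposition e W A P -> hall_into e A P ->
  (forall D, D \in P -> factor_critical e D) -> #|P| = #|A| -> matchable e W.
Proof.
move=> dAP hA crit eqPA.
apply: (@decomposition_assemble _ e (matchable e) W A P P) => //.
- exact: matchable0.
- exact: matchableU.
- exact: matchable2.
- by move=> D x DP xD; apply: crit.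
- by move=> D ->.
- by move=> J JP _; have := hall_dual hA JP; rewrite eqPA; lia.
Qed.

(** As [u] joins the separating set and [D] is lost, [#|P| - #|A|] changes by
    [#|P'| - #|A'| - 2]. *)
Lemma refine_block (W A A' D : {set T}) (P P' : {set {set T}}) (u : T) :
  decomposition e W A P -> D \in P -> u \in D -> decomposition e (D :\ u) A' P' ->
  decomposition e W (u |: A :|: A') (P :\ D :|: P') /\ #|P :\ D :|: P'|.+1 = #|P| + #|P'|.
Proof.
move=> /decompositionP[AW partP oddP sepP] DP uD /decompositionP[A'D partP' oddP' sepP'].
have DWA := partitionS partP DP.
have inD x : x \in D -> x \in W /\ x \notin A.
  by move/(subsetP DWA); rewrite inE => /andP[-> ->].
have blockD B : B \in P' -> B \subset D.
  move=> /(partitionS partP')/subsetP BD; apply/subsetP => x /BD.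
  by rewrite !inE => /and3P[].
have [|part2 card2] := partitionU (partitionD1 partP DP) partP'.
  by rewrite -setI_eq0; apply/eqP/setP => x; rewrite !inE; case: (x \in D); rewrite ?andbF.
split; last by rewrite card2 (cardsD1 D P) DP add1n addSn.
apply/decompositionP; split.
- rewrite !subUset sub1set AW (inD u uD).1 /=; apply/subsetP => x /(subsetP A'D).
  by rewrite !inE => /andP[_ /inD[]].
- rewrite (_ : W :\: _ = (W :\: A) :\: D :|: (D :\ u) :\: A') //.
  apply/setP => x; rewrite !inE; have := inD x; have := subsetP A'D x; rewrite !inE.
  have [xD|xD] := boolP (x \in D) => [_ /(_ isT)[-> /negPf ->]|h _] /=.
    by rewrite orbF; case: (x == u); case: (x \in A').
  have /negPf -> /= : x \notin A' by apply/negP => /h; rewrite andbF.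
  rewrite !andbF !orbF; case: (eqVneq x u) => [xu|//].
  by rewrite xu uD in xD.
- by move=> B; rewrite !inE => /orP[/andP[_ /oddP]|/oddP'].
- have mixed B B' x y : B \in P -> B' \in P' -> x \in B -> y \in B' -> e x y -> B = D.
    move=> BP B'P' xB yB' exy; apply: (sepP B D x y) => //.
    exact: (subsetP (blockD _ B'P')).
  move=> B B' x y; rewrite !inE => /orP[/andP[BD BP]|BP'] /orP[/andP[BD' BP1]|BP1'] xB yB' exy.
  + exact: (sepP _ _ x y).
  + by rewrite (mixed B B' x y) ?eqxx in BD.
  + by rewrite (mixed B' B y x) ?eqxx // e_sym in BD'.
  + exact: (sepP' _ _ x y).
Qed.

(** Since [N] contains every block touched by [Y], no edge joins the new block to the remaining
    ones. If [#|N| <= #|Y|], then [#|P| - #|A|] goes up. *)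
Lemma merge_blocks (W A Y : {set T}) (P N : {set {set T}}) :
  decomposition e W A P -> Y \subset A -> N \subset P ->
  (forall D a, D \in P -> a \in Y -> touches e D a -> D \in N) ->
  odd #|Y :|: cover N| ->
  decomposition e W (A :\: Y) ((Y :|: cover N) |: (P :\: N)) /\
  #|(Y :|: cover N) |: (P :\: N)| + #|N| = #|P|.+1.
Proof.
move=> /decompositionP[AW partP oddP sepP] YA NP touchN oddZ; set Z := Y :|: cover N.
case/and3P: (partP) => /eqP cP tP P0.
have coverN : cover N \subset W :\: A.
  rewrite -cP; apply/bigcupsP => D DN; apply: bigcup_sup; exact: (subsetP NP).
have coverPN : cover (P :\: N) = (W :\: A) :\: cover N.
  apply/setP => x; rewrite -cP inE; apply/bigcupP/andP => [[D]|[xN /bigcupP[D DP xD]]].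
    rewrite inE => /andP[DN DP] xD; split; last by apply/bigcupP; exists D.
    apply: contra DN => /bigcupP[D' D'N xD']; suff -> : D = D' by [].
    by rewrite -(def_pblock tP DP xD) (def_pblock tP (subsetP NP _ D'N) xD').
  exists D; rewrite // inE DP andbT; apply: contra xN => DN; apply/bigcupP; by exists D.
have part1 : partition (P :\: N) ((W :\: A) :\: cover N).
  by rewrite /partition coverPN eqxx trivIsetD // inE (negPf P0) andbF.
have disZ : [disjoint Z & (W :\: A) :\: cover N].
  rewrite -setI_eq0; apply/eqP/setP => x; rewrite !inE.
  case: (x \in cover N) => /=; rewrite ?andbF // orbF.
  by apply: contraTF isT => /and3P[/(subsetP YA) ->].
have part0 : partition [set Z] Z.
  rewrite /partition /cover big_set1 eqxx trivIset1 inE eq_sym.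
  by apply: contraTneq oddZ => h; rewrite -/Z h cards0.
have [part2 card2] := partitionU part0 part1 disZ.
split; last first.
  by rewrite card2 cards1 cardsD (setIidPr NP) add1n addSn subnK ?subset_leq_card.
apply/decompositionP; split.
- exact: subset_trans (subsetDl _ _) AW.
- rewrite (_ : W :\: _ = Z :|: (W :\: A) :\: cover N) //.
  apply/setP => x; have /implyP := subsetP coverN x; have /implyP := subsetP YA x.
  have /implyP := subsetP AW x; rewrite !inE.
  by case: (x \in Y); case: (x \in A); case: (x \in cover N); case: (x \in W).
- by move=> B; rewrite !inE => /orP[/eqP->//|/andP[_ /oddP]].
- have mixed B x y : B \in P :\: N -> x \in B -> y \in Z -> e x y -> B = Z.
    rewrite !inE => /andP[BN BP] xB /orP[yY|/bigcupP[D DN yD]] exy.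
      rewrite (touchN B y) // in BN; apply/existsP; exists x; by rewrite xB.
    by move: BN; rewrite (sepP B D x y) ?DN // (subsetP NP).
  move=> B B' x y; rewrite 2![_ \in _ :|: _]inE !in_set1.
  move=> /orP[/eqP->|BP] /orP[/eqP->|BP'] xB yB' exy //.
  + by symmetry; apply: (mixed B' y x) => //; rewrite e_sym.
  + exact: (mixed B x y).
  + by apply: (sepP B B' x y) => //; [case/setDP: BP|case/setDP: BP'].
Qed.

(* Among the decompositions maximizing [#|P| - #|A|] take one maximizing [#|A|].
   A block that is not factor-critical could be refined, and a subset of [A]
   violating Hall's condition could be merged with the blocks it touches. *)
Lemma critical_decomposition (W : {set T}) :
  exists (A : {set T}) (P : {set {set T}}),
    [/\ decomposition e W A P, hall_into e A P
      & forall D, D \in P -> factor_critical e D].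
Proof.
have [n] := ubnP #|W|; elim: n W => // n IHn W ltn.
have [A [P [dAP mx]]] := maximal_decomposition W; exists A, P.
case/decompositionP: (dAP) => AW partP oddP sepP; split=> //; last first.
  move=> D DP u uD.
  have DW := partitionS partP DP.
  have [|A' [P' [d' h' crit']]] := IHn (D :\ u).
    apply: (@leq_trans #|W|); last by rewrite -ltnS.
    have : #|D| <= #|W| by apply/subset_leq_card/(subset_trans DW)/subsetDl.
    by rewrite (cardsD1 u D) uD.
  have [eq'|neq'] := eqVneq #|P'| #|A'|.
    exact: perfectly_matched_decomposition d' h' crit' eq'.
  have leA' : #|A'| <= #|P'|.
    apply: leq_trans (h' A' (subxx _)) _; apply: subset_leq_card.
    by apply/subsetP => B; rewrite inE => /andP[].
  (* [D :\ u] has even size, so [#|P'|] and [#|A'|] have the same parity. Being different, they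
     differ by at least 2, which pays for the lost block and for [u]. *)
  have := odd_decomposition d'; have := oddP D DP.
  rewrite (cardsD1 u D) uD add1n /= => /negPf -> par.
  have [d2 card2] := refine_block dAP DP uD d'.
  have card3 : #|u |: A :|: A'| <= #|A| + #|A'| + 1.
    apply: leq_trans (leq_card_setU _ _) _; rewrite addnAC leq_add2r addnC.
    by apply: leq_trans (leq_card_setU _ _) _; rewrite cards1.
  have card4 : #|A| < #|u |: A :|: A'|.
    apply: (@leq_trans #|u |: A|); last exact/subset_leq_card/subsetUl.
    rewrite cardsU1 (_ : u \notin A) //.
    by move: (subsetP DW u uD); rewrite inE => /andP[].
  have par2 : #|A'|.+2 <= #|P'|.
    by move: leA' neq' par; move: #|A'| #|P'| => a p; clear; lia.
  have [|] := mx _ _ d2; move: card2 card3 card4 par2; clear; lia.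
move=> Y YA; set N := [set D in P | _]; rewrite leqNgt; apply/negP => ltNY.
have /set0Pn[z zY] : Y != set0 by rewrite -card_gt0 (leq_trans _ ltNY).
have merge (Y' : {set T}) : Y' \subset Y -> #|N| <= #|Y'| -> odd #|Y' :|: cover N| -> False.
  move=> Y'Y leN oddZ.
  have Y'A := subset_trans Y'Y YA.
  have [||d2 card2] := merge_blocks dAP Y'A _ _ oddZ.
  - by apply/subsetP => D; rewrite inE => /andP[].
  - move=> D a DP aY' tDa; rewrite inE DP; apply/existsP; exists a.
    by rewrite (subsetP Y'Y).
  have [|] := mx _ _ d2; rewrite cardsD (setIidPr Y'A);
    move: (subset_leq_card Y'A) leN card2;
    move: #|_ |: _| #|A| #|P| #|N| #|Y'|; clear; lia.
(* The merged block must be odd. Otherwise one vertex [z] of [Y] stays in [A]; the violation is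
   strict, so [#|N| <= #|Y :\ z|] still holds. *)
have [oddZ|evenZ] := boolP (odd #|Y :|: cover N|); first by apply: (merge Y); rewrite // ltnW.
apply: (merge (Y :\ z)); first exact: subsetDl.
  by move: ltNY; rewrite (cardsD1 z) zY.
have zN : z \notin cover N.
  apply/negP => /bigcupP[D]; rewrite inE => /andP[DP _] zD.
  by have := subsetP (partitionS partP DP) z zD; rewrite inE (subsetP YA).
move: evenZ; rewrite (cardsD1 z) !inE zY /= negbK; congr (odd #|pred_of_set _|).
apply/setP => x; rewrite !inE; case: (eqVneq x z) => [->|//].
by rewrite (negPf zN).
Qed.

End CriticalDecomposition.

(** * Alternating paths from a root of a block *)

Section AlternatingPaths.
Variables (T : finType) (e : rel T).
Hypotheses (e_sym : symmetric e) (e_irr : irreflexive e).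
Variables (D : {set T}) (v : T) (mu : T -> T).
Hypotheses (vD : v \in D) (mu_pm : perfect_matching e (D :\ v) mu).

(* The alternating path [v, mu y1, y1, mu y2, y2, ...] is encoded by the
   sequence [y1, y2, ...] of the far ends of its matching edges. *)
Definition alt_step (a b : T) : bool := e a (mu b).
Definition medge (x : T) : {set T} := [set x; mu x].
(** Edges rather than vertices are compared, since an edge may be named by either end. *)
Definition alt_free (s : seq T) : bool :=
  uniq (map medge s) && all (fun E : {set T} => E \subset D :\ v) (map medge s).
(** The same path read backwards, each edge now named by its other end. *)
Definition alt_flip (s : seq T) : seq T := rev (map mu s).

Let muK : involutive mu. Proof. by case: mu_pm. Qed.

Lemma mu_in x : x \in D :\ v -> mu x \in D :\ v.
Proof. by case: mu_pm => _ h _ /h[]. Qed.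

Lemma mu_adj x : x \in D :\ v -> e x (mu x).
Proof. by case: mu_pm => _ h _ /h[]. Qed.

Lemma mu_root : mu v = v.
Proof. by case: mu_pm => _ _; apply; rewrite !inE eqxx. Qed.

Lemma medge_mu x : medge (mu x) = medge x.
Proof. by rewrite /medge muK setUC. Qed.

Lemma medge_eq x y : medge x = medge y -> x = y \/ x = mu y.
Proof.
move=> h; have : x \in medge y by rewrite -h !inE eqxx.
by rewrite !inE => /orP[] /eqP; [left|right].
Qed.

Lemma medge_sub x : (medge x \subset D :\ v) = (x \in D :\ v).
Proof.
rewrite subUset !sub1set andb_idr //; exact: mu_in.
Qed.

Lemma alt_free_perm s t :
  perm_eq (map medge s) (map medge t) -> alt_free s = alt_free t.
Proof. by move=> h; rewrite /alt_free (perm_uniq h) (perm_all _ h). Qed.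

Lemma alt_free_subseq s t : subseq s t -> alt_free t -> alt_free s.
Proof.
move=> /(map_subseq medge) st /andP[ut /allP at_]; rewrite /alt_free (subseq_uniq st ut).
by apply/allP => E /(mem_subseq st)/at_.
Qed.

Lemma alt_free_in s x : alt_free s -> x \in s -> x \in D :\ v.
Proof.
by move=> /andP[_ /allP h] xs; rewrite -medge_sub; apply: h; apply: map_f.
Qed.

Lemma medge_flip s : map medge (alt_flip s) = rev (map medge s).
Proof. by rewrite map_rev -map_comp; congr rev; apply: eq_map => x /=; apply: medge_mu. Qed.

Lemma size_flip s : size (alt_flip s) = size s.
Proof. by rewrite size_rev size_map. Qed.

Lemma alt_flip_cat s x t :
  alt_flip (s ++ x :: t) = alt_flip t ++ mu x :: alt_flip s.
Proof. by rewrite /alt_flip map_cat rev_cat /= rev_cons cat_rcons. Qed.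

Lemma alt_step_mu a b : alt_step (mu b) (mu a) = alt_step a b.
Proof. by rewrite /alt_step muK e_sym. Qed.

Lemma sorted_flip s : sorted alt_step (alt_flip s) = sorted alt_step s.
Proof.
rewrite rev_sorted sorted_map; apply: eq_sorted => a b /=; exact: alt_step_mu.
Qed.

Lemma cycle_flip s : cycle alt_step (alt_flip s) = cycle alt_step s.
Proof.
rewrite rev_cycle; case: s => // x s; rewrite /= -map_rcons path_map.
by apply: eq_path => a b; apply: alt_step_mu.
Qed.

(* With [nu] a perfect matching of [D :\ u], the iterates of [mu \o nu] run along the
   component of [v] in the union of the two matchings; the orbit has odd length
   [2 t + 1], and the vertex reached after [t] steps is the other fixed end [u]. *)
Lemma alternating_path_to u : factor_critical e D -> u \in D ->
  exists s, [/\ path alt_step v s, alt_free s & last v s = u].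
Proof.
move=> crit uD; have [nu [nuK nu_in nu_out]] := crit u uD.
pose sg x := mu (nu x).
have sg_inj : injective sg by move=> x y /(inv_inj muK)/(inv_inj nuK).
have inj_iter n : injective (iter n sg) by elim: n => // n IH x y /= /sg_inj/IH.
have sgD x : x \in D -> sg x \in D.
  move=> xD; have nuD : nu x \in D.
    have [->|xu] := eqVneq x u; first by rewrite nu_out // !inE eqxx.
    by case: (nu_in x); rewrite !inE ?xu // => /andP[].
  rewrite /sg; have [->|yv] := eqVneq (nu x) v; first by rewrite mu_root.
  by have := @mu_in (nu x); rewrite !inE yv nuD => /(_ isT)/andP[].
have xD i : iter i sg v \in D by elim: i => // i IH; apply: sgD.
set N := order sg v.
have N0 : 0 < N by apply: order_gt0.
have itN : iter N sg v = v by apply: iter_order.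
have notv i : 0 < i < N -> iter i sg v != v.
  case/andP=> i0 iN; apply/eqP => h; have := findex_iter iN; rewrite h findex0.
  by move=> i_eq; rewrite -i_eq in i0.
(* Conjugation by [mu] inverts [sg]. *)
have refl x i : iter i sg (mu (iter i sg x)) = mu x.
  elim: i => // i IH; rewrite iterSr [iter i.+1 sg x]/= -[RHS]IH; congr iter.
  by rewrite /sg muK nuK.
have reflv i : iter i sg (mu (iter i sg v)) = v by rewrite refl mu_root.
have mu_fix x : x \in D -> mu x = x -> x = v.
  move=> xD' mux; apply/eqP; apply: contraT => xv.
  by have := @mu_adj x; rewrite !inE xv xD' mux e_irr => /(_ isT).
(* If the orbit had length [m + m], [mu] would fix the vertex after [m] steps, but its only fixed
   point in [D] is [v]. *)
have oddN : odd N.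
  apply: contraT => evN; pose m := N./2.
  have Nm : N = m + m by rewrite addnn -(odd_double_half N) (negPf evN).
  have : mu (iter m sg v) = iter m sg v.
    by apply: (inj_iter m); rewrite reflv -iterD -Nm itN.
  by move/(mu_fix _ (xD m))/eqP; apply: contraTT => _; apply: notv; lia.
pose t := N./2.
have Nt : N = t.*2.+1 by rewrite -(odd_double_half N) oddN.
have xt : iter t sg v = u.
  (* Another [t + 1] steps lead both sides to [v], so [nu] fixes this vertex; the only such vertex
     in [D] is [u]. *)
  have fixnu : nu (iter t sg v) = iter t sg v.
    have -> : nu (iter t sg v) = mu (iter t.+1 sg v) by rewrite /= /sg muK.
    apply: (inj_iter t.+1); rewrite reflv -iterD addSn addnn -Nt.
    by rewrite itN.
  apply/eqP; apply: contraT => xu.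
  by case: (nu_in (iter t sg v)); rewrite ?inE ?xu ?xD // fixnu e_irr.
have xi_inj i j : i < N -> j < N -> iter i sg v = iter j sg v -> i = j.
  by move=> iN jN h; rewrite -(findex_iter iN) -(findex_iter jN) h.
exists (traject sg (sg v) t); split; last 1 first.
- by rewrite last_traject.
- have : forall i n, i + n <= t -> path alt_step (iter i sg v) (traject sg (iter i.+1 sg v) n).
    move=> i n; elim: n i => // n IH i lei /=; apply/andP; split; last first.
      by apply: (IH i.+1); lia.
    rewrite /alt_step /sg muK; apply: (nu_in _ _).2; rewrite !inE xD andbT -xt.
    apply/eqP => /xi_inj; lia.
  by move=> /(_ 0 t); apply; rewrite add0n.
have trajE : traject sg (sg v) t = [seq iter i sg v | i <- iota 1 t].
  apply: (@eq_from_nth _ v); first by rewrite size_traject size_map size_iota.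
  move=> i; rewrite size_traject => it.
  by rewrite (set_nth_default (sg v)) ?size_traject // nth_traject //
    (nth_map 0) ?size_iota // nth_iota // add1n -iterSr.
rewrite /alt_free trajE -map_comp; apply/andP; split.
  rewrite map_inj_in_uniq ?iota_uniq // => i j; rewrite !mem_iota => hi hj /=.
  (* If the [i]-th and [j]-th vertices were partners under [mu], the orbit would close after [i + j]
     steps, too early. *)
  case/medge_eq => [|h]; first by apply: xi_inj; lia.
  have : iter (j + i) sg v = v by rewrite iterD h reflv.
  by move/eqP; apply: contraTeq => _; apply: notv; lia.
apply/allP => E /mapP[i]; rewrite mem_iota => hi -> /=.
by rewrite medge_sub !inE xD andbT notv //; lia.
Qed.

(** * Length bounds when all alternating paths from the root are short *)

Variable k : nat.
Hypothesis crit : factor_critical e D.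
Hypothesis short : forall s, path alt_step v s -> alt_free s -> size s < k.

(** A path from [v] that enters [L ++ q :: R] at [q] in its direction can continue along [R], and
    [short] applies to the result. *)
Lemma follow_path s L q R : path alt_step v (rcons s q) ->
  sorted alt_step (L ++ q :: R) -> alt_free (s ++ L ++ q :: R) -> size s + (size R).+1 < k.
Proof.
move=> ps srt fr; have -> : size s + (size R).+1 = size (s ++ q :: R) by rewrite size_cat.
apply: short.
  rewrite -cat_rcons cat_path ps last_rcons /=.
  by move: srt; rewrite sorted_cat_cons => /andP[].
by apply: alt_free_subseq fr; apply: cat_subseq => //; apply: suffix_subseq.
Qed.

Lemma alt_free_flip s L : alt_free (s ++ alt_flip L) = alt_free (s ++ L).
Proof.
by apply: alt_free_perm; rewrite !map_cat perm_cat2l medge_flip perm_rev.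
Qed.

Lemma alt_free_rcons_cat s q qs P : alt_free (s ++ q :: qs) -> alt_free (s ++ P) ->
  medge q \notin map medge P -> alt_free (rcons s q ++ P).
Proof.
rewrite -cat_rcons /alt_free !map_cat !all_cat => /andP[].
rewrite !cat_uniq => /and3P[uq _ _] /andP[-> _] /andP[/and3P[us hs ->]] /andP[_ ->] qP.
rewrite uq /= !andbT; apply/hasPn => E EP.
rewrite map_rcons mem_rcons inE negb_or (hasPn hs) // andbT.
by apply: contraTneq EP => ->.
Qed.

(* Follow a path [s ++ qs] from [v] to the matching edge of [c]. Each time it
   enters the part of [P1 ++ c :: P2] it has not yet destroyed, it could instead
   stay on it up to the next end, so what it cuts off is at most what is left of
   its length budget; the budget drops by one each time. *)
Lemma approach_bound qs s P1 c P2 : path alt_step v (s ++ qs) -> alt_free (s ++ qs) ->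
  sorted alt_step (P1 ++ c :: P2) -> alt_free (s ++ P1 ++ c :: P2) ->
  medge (last v qs) = medge c ->
  let n := k.-1 - size s in
  2 * (size P1).+1 <= n * n.+1 \/ 2 * (size P2).+1 <= n * n.+1.
Proof.
elim: qs s P1 c P2 => [|q qs IH] s P1 c P2 pq fq srt fr lastc n.
  have : c \in D :\ v by apply: alt_free_in fr _; rewrite !mem_cat inE eqxx !orbT.
  by rewrite -medge_sub -lastc medge_sub !inE eqxx.
have pq1 : path alt_step v (rcons s q) by move: pq; rewrite -cat_rcons cat_path => /andP[].
have sizes : size (s ++ q :: qs) < k by apply: short.
have n0 : 0 < n by rewrite /n; move: sizes; rewrite size_cat /=; lia.
have last_qs : medge q != medge c -> medge (last v qs) = medge c.
  by case: qs lastc {IH pq fq sizes} => //= ->; rewrite eqxx.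
have nS : k.-1 - size (rcons s q) = n.-1 by rewrite size_rcons /n; clear; lia.
have small a : a < k -> size s + a < k -> 2 * a <= n * n.+1.
  by move=> h1 h2; have : a <= n; [move: h2; rewrite /n; clear; lia|clear; nia].
(* Stated for any path through the edge of [c], so that it also applies to the flipped path, where a
   hit in [P2] becomes a hit on the left. *)
have left_case (P1' : seq T) c' P2' : sorted alt_step (P1' ++ c' :: P2') ->
    alt_free (s ++ P1' ++ c' :: P2') -> medge c' = medge c ->
    medge q \in map medge P1' ->
    2 * (size P1').+1 <= n * n.+1 \/ 2 * (size P2').+1 <= n * n.+1.
  move=> srt' fr' c'c /mapP[b bP qb].
  have qc : medge q != medge c.
    apply/eqP => qc; move: fr' => /andP[+ _]; rewrite !map_cat !cat_uniq.
    case/and3P=> _ _ /and3P[_ /hasPn/(_ (medge c'))]; rewrite inE eqxx => /(_ isT) + _.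
    by move/negP; apply; rewrite c'c -qc qb; apply: map_f.
  case/splitPr: bP srt' fr' => L R srt' fr'.
  case/medge_eq: qb => qb.
    right; have := @follow_path s L q (R ++ c' :: P2') pq1.
    have -> : L ++ q :: R ++ c' :: P2' = (L ++ b :: R) ++ c' :: P2' by rewrite qb -catA.
    move=> /(_ srt' fr').
    by rewrite size_cat /= => h; apply: small; move: h; clear; lia.
  have flipE : alt_flip ((L ++ b :: R) ++ c' :: P2') =
      (alt_flip P2' ++ mu c' :: alt_flip R) ++ mu b :: alt_flip L.
    by rewrite alt_flip_cat alt_flip_cat -catA.
  (* The edge of [b] is met against the direction of [P1'], so the path could run out along [L],
     which bounds [L]. The recursion drops [L] and [b], and 2 n + (n - 1) n = n (n + 1). *)
  have sizeL : 2 * (size L).+1 <= 2 * n.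
    have := @follow_path s (alt_flip P2' ++ mu c' :: alt_flip R) (mu b) (alt_flip L).
    rewrite -flipE alt_free_flip sorted_flip -qb => /(_ pq1 srt' fr').
    by rewrite size_flip /n leq_mul2l; move: (size s) (size L); clear; lia.
  have srtR : sorted alt_step (R ++ c' :: P2').
    move: srt'; rewrite -catA sorted_cat_cons => /andP[_]; exact: path_sorted.
  have frR : alt_free (rcons s q ++ R ++ c' :: P2').
    have -> : alt_free (rcons s q ++ R ++ c' :: P2') = alt_free (s ++ b :: R ++ c' :: P2').
      by apply: alt_free_perm; rewrite cat_rcons !map_cat /= !map_cat qb medge_mu.
    apply: alt_free_subseq fr'; apply: cat_subseq => //; rewrite -catA.
    exact: suffix_subseq.
  have := IH (rcons s q) R c' P2'; rewrite cat_rcons nS c'c => /(_ pq fq srtR frR).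
  move=> /(_ (last_qs qc)) [h|h]; [left|right].
    by move: h sizeL n0; rewrite size_cat /=; clear; nia.
  by move: h n0; clear; nia.
have [qP1|qP1] := boolP (medge q \in map medge P1); first exact: (left_case P1 c P2).
have flipP : alt_flip (P1 ++ c :: P2) = alt_flip P2 ++ mu c :: alt_flip P1.
  exact: alt_flip_cat.
have [qP2|qP2] := boolP (medge q \in map medge P2).
  have := left_case (alt_flip P2) (mu c) (alt_flip P1); rewrite -flipP.
  rewrite sorted_flip alt_free_flip medge_mu !size_flip => /(_ srt fr erefl).
  by rewrite medge_flip mem_rev => /(_ qP2) [h|h]; [right|left].
have [/medge_eq[qc|qc]|qc] := eqVneq (medge q) (medge c).
- right; have := @follow_path s P1 q P2 pq1; rewrite qc => /(_ srt fr) h.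
  by apply: small; move: h; clear; lia.
- left; have := @follow_path s (alt_flip P2) q (alt_flip P1) pq1.
  rewrite qc -flipP sorted_flip alt_free_flip => /(_ srt fr).
  by rewrite size_flip => h; apply: small; move: h; clear; lia.
have frq : alt_free (rcons s q ++ P1 ++ c :: P2).
  apply: alt_free_rcons_cat fq fr _.
  by rewrite map_cat mem_cat inE !negb_or qP1 qc.
have := IH (rcons s q) P1 c P2; rewrite cat_rcons nS => /(_ pq fq srt frq (last_qs qc)).
by move=> [h|h]; [left|right]; move: h n0; clear; nia.
Qed.

(** Use [approach_bound] for the middle edge with [s] empty: either side together with the middle
    edge makes up at least half of [P]. *)
Lemma alternating_size P : sorted alt_step P -> alt_free P -> size P <= k * k.-1.
Proof.
case: (posnP (size P)) => [-> //|P0] srt fr.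
pose i := (size P)./2; have iP : i < size P by rewrite /i; lia.
have PE : P = take i P ++ nth v P i :: drop i.+1 P by rewrite -drop_nth // cat_take_drop.
have cD : nth v P i \in D by have := alt_free_in fr (mem_nth v iP); rewrite !inE => /andP[].
have [s [ps fs lasts]] := alternating_path_to crit cD.
have := @approach_bound s [::] (take i P) (nth v P i) (drop i.+1 P) ps fs.
rewrite !cat0s -PE lasts => /(_ srt fr erefl).
rewrite /= size_take iP size_drop subn0 => -[]; rewrite /i; move: P0; clear; nia.
Qed.

(** Stop at the first edge shared with [P], so that the part before it avoids [P]. *)
Lemma first_hit P qs s : path alt_step v (s ++ qs) -> alt_free (s ++ qs) ->
  alt_free (s ++ P) -> medge (last v qs) \in map medge P ->
  exists s' q, [/\ path alt_step v (rcons s' q), alt_free (s' ++ P) & medge q \in map medge P].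
Proof.
elim: qs s => [|q qs IH] s pq fq fr lastP.
  case/mapP: lastP => c cP vc.
  have : c \in D :\ v by apply: alt_free_in fr _; rewrite mem_cat cP orbT.
  by rewrite -medge_sub -vc medge_sub !inE eqxx.
have [qP|qP] := boolP (medge q \in map medge P).
  by exists s, q; split=> //; move: pq; rewrite -cat_rcons cat_path => /andP[].
apply: (IH (rcons s q)); rewrite ?[rcons s q ++ qs]cat_rcons //; last first.
  by case: qs lastP {IH pq fq} => //=; rewrite (negPf qP).
exact: alt_free_rcons_cat fq fr qP.
Qed.

(** A path from [v] to the first edge it shares with the cycle could go once around it, in the
    direction in which it enters. *)
Lemma alternating_cycle_size P : cycle alt_step P -> alt_free P -> size P < k.
Proof.
move=> cyc fr; case: (posnP (size P)) => [->|P0]; first exact: (@short [::]).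
have hP : nth v P 0 \in P by apply: mem_nth.
have hD : nth v P 0 \in D by have := alt_free_in fr hP; rewrite !inE => /andP[].
have [qs [pqs fqs lastqs]] := alternating_path_to crit hD.
have [|s [q [ps fs /mapP[b bP qb]]]] := @first_hit P qs [::] pqs fqs fr.
  by rewrite lastqs; apply: map_f.
have turn R : q \in R -> cycle alt_step R -> alt_free (s ++ R) -> size R < k.
  move=> qR; have [i R' rotR] := rot_to qR => cycR frR.
  have perR : perm_eq R (q :: R') by rewrite -rotR perm_sym perm_rot.
  rewrite (perm_size perR); apply: leq_ltn_trans (leq_addl (size s) _) _.
  rewrite -size_cat; apply: short.
    rewrite -cat_rcons cat_path ps last_rcons /=.
    by move: cycR; rewrite -(rot_cycle i) rotR /= rcons_path => /andP[].
  rewrite -(@alt_free_perm (s ++ R)) // !map_cat perm_cat2l; exact: perm_map.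
case/medge_eq: qb => qb; first by apply: turn; rewrite ?qb.
rewrite -size_flip.
apply: turn; rewrite ?cycle_flip ?alt_free_flip //.
by rewrite qb mem_rev map_f.
Qed.

(** * Independent sets from ends of maximal alternating paths *)

Lemma alt_free_cons x s : alt_free (x :: s) =
  [&& medge x \notin map medge s, x \in D :\ v & alt_free s].
Proof.
rewrite /alt_free /= medge_sub; case: (medge x \in _) => //=; by rewrite andbCA.
Qed.

(** Extend inside [S] at either end while possible; [alternating_size] makes this stop. The outer
    ends of the path are [last h p] and [mu h]. *)
Lemma maximal_alternating (S : {set T}) x0 : S \subset D :\ v ->
  {in S, forall x, mu x \in S} -> x0 \in S ->
  exists h p, [/\ path alt_step h p, alt_free (h :: p), {subset h :: p <= S},
    forall w, w \in S -> e (last h p) w -> medge w \in map medge (h :: p)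
  & forall w, w \in S -> e w (mu h) -> medge w \in map medge (h :: p)].
Proof.
move=> SD muS x0S.
suff ext n h p : k * k.-1 - size p < n -> path alt_step h p -> alt_free (h :: p) ->
    {subset h :: p <= S} ->
    exists h p, [/\ path alt_step h p, alt_free (h :: p), {subset h :: p <= S},
      forall w, w \in S -> e (last h p) w -> medge w \in map medge (h :: p)
    & forall w, w \in S -> e w (mu h) -> medge w \in map medge (h :: p)].
  apply: (ext _ x0 [::] (ltnSn _)) => //.
    by rewrite alt_free_cons (subsetP SD).
  by move=> x; rewrite inE => /eqP->.
elim: n h p => // n IH h p ltn php fr sub.
have bound : size p < k * k.-1 by apply: (alternating_size (P := h :: p)).
have [/existsP[w /and3P[wS ew nw]]|noR] :=
    boolP [exists w, [&& w \in S, e (last h p) w & medge w \notin map medge (h :: p)]].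
  (* The new edge is entered at [w], so its far end is [mu w]. *)
  apply: (IH h (rcons p (mu w))).
  - by move: ltn bound; rewrite size_rcons; move: (size p) (k * k.-1); clear; lia.
  - by rewrite rcons_path php /alt_step muK.
  - rewrite -rcons_cons (@alt_free_perm _ (w :: h :: p)).
      by rewrite alt_free_cons nw (subsetP SD).
    by rewrite map_rcons perm_rcons /= medge_mu.
  - move=> x; rewrite -rcons_cons mem_rcons inE => /orP[/eqP->|/sub//]; exact: muS.
have [/existsP[w /and3P[wS ew nw]]|noL] :=
    boolP [exists w, [&& w \in S, e w (mu h) & medge w \notin map medge (h :: p)]].
  apply: (IH w (h :: p)).
  - by move: ltn bound => /=; move: (size p) (k * k.-1); clear; lia.
  - by rewrite /= php andbT.
  - by rewrite alt_free_cons nw (subsetP SD).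
  - by move=> x; rewrite inE => /orP[/eqP->|/sub].
exists h, p; split=> // w wS ew; apply: contraT => nw.
  by case/negP: noR; apply/existsP; exists w; rewrite wS ew.
by case/negP: noL; apply/existsP; exists w; rewrite wS ew.
Qed.

(** Remove the vertices of a maximal path and recurse; its ends have no neighbours in the rest of
    [S], so they can join the set. A path with fewer than [k] edges of [mu] costs at most 2 (k - 1)
    vertices and yields one end; a longer one costs at most 2 k (k - 1) and yields both. *)
Lemma greedy_independent_set (S : {set T}) : 1 < k -> S \subset D :\ v ->
  {in S, forall x, mu x \in S} ->
  exists I : {set T}, [/\ I \subset S, forall x y, x \in I -> y \in I -> ~~ e x y
    & #|S| <= k * k.-1 * #|I|].
Proof.
move=> k1; have [n] := ubnP #|S|; elim: n S => // n IH S ltn SD muS.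
have [->|[x0 x0S]] := set_0Vmem S.
  by exists set0; rewrite sub0set !cards0; split=> // x; rewrite inE.
have [h [p [php fr sub maxR maxL]]] := maximal_alternating SD muS x0S.
set P := h :: p in fr sub maxR maxL; set y := last h p; set z := mu h.
pose U := [set x in S | medge x \in map medge P].
have cardU : #|U| <= 2 * size P.
  have -> : 2 * size P = size (P ++ map mu P) by rewrite size_cat size_map; lia.
  apply: leq_trans (card_size _); apply: subset_leq_card; apply/subsetP => x.
  rewrite inE => /andP[_ /mapP[b bP /medge_eq[->|->]]]; rewrite mem_cat ?bP //.
  by rewrite map_f ?orbT.
have inU x : x \in P -> x \in U by move=> xP; rewrite inE sub // map_f.
have yP : y \in P by apply: mem_last.
have hP : h \in P by apply: mem_head.
have zS : z \in S by apply: muS; apply: sub.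
have zU : z \in U by rewrite inE zS medge_mu map_f.
have [|||I [IS indI cardI]] := IH (S :\: U).
- apply: leq_trans (_ : #|S| <= n); last by rewrite -ltnS.
  apply: proper_card; apply/properP; split; first exact: subsetDl.
  by exists h; rewrite ?sub // inE inU.
- exact: subset_trans (subsetDl _ _) SD.
- move=> x; rewrite !inE => /andP[xU xS]; rewrite muS // andbT medge_mu.
  by move: xU; rewrite xS.
have IS' x : x \in I -> x \in S /\ medge x \notin map medge P.
  by move/(subsetP IS); rewrite !inE => /andP[+ xS]; rewrite xS.
have yI x : x \in I -> ~~ e y x.
  by move=> /IS'[xS]; apply: contra; apply: maxR.
have zI x : x \in I -> ~~ e x z.
  by move=> /IS'[xS]; apply: contra; apply: maxL.
have UI x : x \in U -> x \notin I.
  by rewrite inE => /andP[_]; apply: contraL => /IS'[].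
have cardS : #|S| <= #|U| + #|S :\: U|.
  by rewrite cardsD (setIidPr _) ?subnKC ?subset_leq_card //;
    apply/subsetP => x; rewrite inE => /andP[].
have IsubS : I \subset S := subset_trans IS (subsetDl _ _).
have [small|big] := ltnP (size P) k.
  exists (y |: I); split.
  - by rewrite subUset sub1set IsubS sub.
  - move=> a b; rewrite !inE => /orP[/eqP->|aI] /orP[/eqP->|bI].
    + by rewrite e_irr.
    + exact: yI.
    + by rewrite e_sym yI.
    + exact: indI.
  rewrite cardsU1 UI ?inU // add1n mulnS.
  apply: leq_trans cardS _; apply: leq_add => //; apply: leq_trans cardU _.
  by apply: leq_mul => //; move: small; clear; lia.
(* An edge between the ends would close an alternating cycle with at least [k] edges of [mu]. *)
have yz : ~~ e y z.
  apply/negP => eyz; suff : size P < k by rewrite ltnNge big.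
  by apply: alternating_cycle_size => //; rewrite /= rcons_path php.
(* The path has at least [k > 1] edges of [mu], and the two ends lie on different ones. *)
have ynz : y != z.
  have yp : y \in p.
    move: big k1; rewrite /y /P; case: (p) => [|a p'] /=; last by rewrite mem_last.
    by clear; lia.
  apply/eqP => yz'; move: fr => /andP[/= /andP[/negP + _] _]; apply.
  by rewrite -medge_mu -/z -yz'; apply: map_f.
exists (y |: (z |: I)); split.
- by rewrite !subUset !sub1set IsubS zS sub.
- move=> a b; rewrite !inE => /or3P[/eqP->|/eqP->|aI] /or3P[/eqP->|/eqP->|bI];
    rewrite ?e_irr //; [exact: yI|by rewrite e_sym|by rewrite e_sym zI| | |].
  + by rewrite e_sym yI.
  + exact: zI.
  + exact: indI.
rewrite !cardsU1 !inE negb_or ynz (UI y (inU y yP)) (UI z zU) /= !add1n 2!mulnS addnA.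
apply: leq_trans cardS _; apply: leq_add => //; apply: leq_trans cardU _.
by rewrite mul2n -addnn leq_add // (alternating_size (P := P)).
Qed.

(** With d = [#|D| - 1], i = [#|I|] and i >= 1, the bound d <= k (k - 1) i gives 5 (d + 2 - i) <= 5
    d + 5 i <= 6 k^2 i. A block reduced to [v] is its own independent set. *)
Lemma short_block_independent_set : 1 < k ->
  exists I : {set T}, [/\ I \subset D, forall x y, x \in I -> y \in I -> ~~ e x y
    & 5 * (#|D :\: I| + 1) <= 6 * k ^ 2 * #|I|].
Proof.
move=> k1; have cardD := cardsD1 v D; rewrite vD in cardD.
have [D0|D0] := posnP #|D :\ v|.
  exists [set v]; split; rewrite ?sub1set //.
    by move=> x y /set1P-> /set1P->; rewrite e_irr.
  by rewrite D0 cards1 expnS expn1; move: k1; clear; nia.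
have [I [ID indI cardI]] := greedy_independent_set k1 (subxx (D :\ v)) mu_in.
exists I; split=> //; first exact: subset_trans ID (subsetDl _ _).
have ID' : I \subset D := subset_trans ID (subsetDl _ _).
rewrite cardsD (setIidPr ID') expnS expn1.
have := subset_leq_card ID'; rewrite cardD add1n.
move: D0 cardI k1; move: #|I| #|D :\ v| => i d; clear => d0 cardI k1 _.
have i0 : 0 < i by case: i cardI => //; rewrite muln0; lia.
have -> : k * k = k * k.-1 + k by case: k k1 => // m _ /=; nia.
by move: cardI; move: (k * k.-1) => w; nia.
Qed.
End AlternatingPaths.

(** * Tilings by paths *)

Section Tilings.
Variables (T : finType) (e : rel T) (m : nat).
Hypotheses (e_sym : symmetric e) (e_irr : irreflexive e).

(** A single [uniq] on the flattening makes the paths disjoint and free of repetitions; chords in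
    [e] are allowed. *)
Definition tiled (S : {set T}) : Prop :=
  exists ts : seq (seq T), [/\ uniq (flatten ts), flatten ts =i S
    & forall t, t \in ts -> ((size t == 2) || (size t == m)) && sorted e t].

Lemma tiled0 : tiled set0.
Proof. by exists [::]; split=> // x; rewrite inE. Qed.

Lemma tiledU (S R : {set T}) : [disjoint S & R] -> tiled S -> tiled R -> tiled (S :|: R).
Proof.
move=> dis [ts [uts eqts okts]] [us [uus equs okus]]; exists (ts ++ us); split.
- rewrite flatten_cat cat_uniq uts uus andbT; apply/hasPn => x.
  by rewrite /= eqts equs => xR; rewrite (disjointFl dis).
- by move=> x; rewrite flatten_cat mem_cat inE eqts equs.
- by move=> t; rewrite mem_cat => /orP[/okts|/okus].
Qed.

Lemma tiled_path t : uniq t -> sorted e t -> (size t == 2) || (size t == m) ->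
  tiled [set x in t].
Proof.
move=> ut st szt; exists [:: t]; split=> [|x|t']; rewrite /= ?cats0 ?inE //.
by move=> /eqP->; rewrite szt.
Qed.

Lemma tiled2 x y : e x y -> tiled [set x; y].
Proof.
move=> exy; have -> : [set x; y] = [set z in [:: x; y]] by apply/setP => z; rewrite !inE.
apply: tiled_path => //=; last by rewrite exy.
by rewrite inE andbT; apply: contraTneq exy => ->; rewrite e_irr.
Qed.

Lemma matchable_sub (S R : {set T}) nu : perfect_matching e S nu -> R \subset S ->
  {in R, forall x, nu x \in R} -> matchable e R.
Proof.
move=> [nuK nuS nu0] RS nuR; exists (fun x => if x \in R then nu x else x).
split=> x; last by move/negPf ->.
  by have [xR|/negPf xR] := boolP (x \in R); rewrite ?nuR ?nuK // xR.
by move=> xR; rewrite xR nuR //; case: (nuS x (subsetP RS x xR)).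
Qed.

Lemma matchable_tiled (S : {set T}) : matchable e S -> tiled S.
Proof.
have [n] := ubnP #|S|; elim: n S => // n IH S ltn [nu pm]; case: (pm) => nuK nuS nu0.
have [->|[x xS]] := set_0Vmem S; first exact: tiled0.
have [nuxS exnu] := nuS x xS.
have SE : S = (S :\: [set x; nu x]) :|: [set x; nu x].
  apply/setP => y; rewrite !inE.
  have [->|_] := eqVneq y x; first by rewrite xS orbT.
  by have [->|_] := eqVneq y (nu x); rewrite ?nuxS ?orbT ?orbF.
rewrite SE; apply: tiledU; last exact: tiled2.
  by rewrite -setI_eq0 setIDAC setDIl setDv setI0.
apply: IH.
  apply: leq_trans (_ : #|S| <= n); last by rewrite -ltnS.
  apply: proper_card; apply/properP; split; first exact: subsetDl.
  by exists x; rewrite // !inE eqxx.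
apply: matchable_sub pm (subsetDl _ _) _ => y; rewrite !inE negb_or => /andP[/andP[yx ynu] yS].
rewrite (nuS y yS).1 andbT negb_or (inj_eq (inv_inj nuK)) yx andbT.
by apply: contraNneq ynu => <-; rewrite nuK.
Qed.

End Tilings.

(** * From tilings to path factors *)

Section TilingToFactor.
Variables (T : finType) (e : rel T) (m : nat).
Hypotheses (e_sym : symmetric e).

Definition consecutive (t : seq T) (x y : T) : bool :=
  [&& x \in t, y \in t & ((index x t).+1 == index y t) || ((index y t).+1 == index x t)].

Lemma consecutive_nth t x0 i j : uniq t -> i < size t -> j < size t ->
  consecutive t (nth x0 t i) (nth x0 t j) = (i.+1 == j) || (j.+1 == i).
Proof. by move=> ut it jt; rewrite /consecutive !mem_nth // !index_uniq. Qed.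

Lemma consecutive_adj t x y : sorted e t -> consecutive t x y -> e x y.
Proof.
move=> st; wlog xy : x y / (index x t).+1 = index y t.
  move=> H /and3P[xt yt /orP[] /eqP h]; first by apply: H => //; rewrite /consecutive xt yt h eqxx.
  by rewrite e_sym; apply: H => //; rewrite /consecutive xt yt h eqxx.
case/and3P=> xt yt _; have it : (index x t).+1 < size t by rewrite xy index_mem.
by have := sortedP x st _ it; rewrite nth_index // xy nth_index.
Qed.

(** [H] keeps only the edges between consecutive vertices of a tile. Its components are then the
    tiles, and dropping the chords makes each of them an induced path. *)
Lemma tiled_factor : tiled e m [set: T] -> has_P2_Pm_factor e m.
Proof.
case=> ts [uts eqts okts]; pose H x y := has (fun t => consecutive t x y) ts.
have ts_uniq t : t \in ts -> uniq t.
  move=> tts; move: uts; rewrite (perm_uniq (perm_flatten (perm_to_rem tts))) /=.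
  by rewrite cat_uniq => /and3P[].
have same t t' x : t \in ts -> t' \in ts -> x \in t -> x \in t' -> t = t'.
  move=> tts t'ts xt xt'; apply/eqP; apply: contraT => tt'.
  move: uts; rewrite (perm_uniq (perm_flatten (perm_to_rem tts))) /= cat_uniq.
  case/and3P=> _ /hasPn/(_ x) /= h _; move: h; rewrite xt; apply.
  apply/flattenP; exists t' => //; move: t'ts; rewrite (perm_mem (perm_to_rem tts)).
  by rewrite inE eq_sym (negPf tt').
have HE t x y : t \in ts -> x \in t -> H x y = consecutive t x y.
  move=> tts xt; apply/hasP/idP => [[t' t'ts c]|c]; last by exists t.
  by case/and3P: (c) => xt' _ _; rewrite (same t t' x).
have Hsym : symmetric H.
  move=> x y; apply: eq_has => t; rewrite /consecutive andbCA [X in _ && (_ && X)]orbC.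
  by [].
exists H; split=> //; split.
  by move=> x y /hasP[t /okts/andP[_ st]]; apply: consecutive_adj.
move=> C /existsP[x /andP[_ /eqP->]].
have [t tts xt] : exists2 t, t \in ts & x \in t.
  by apply/flattenP; rewrite eqts inE.
have ut := ts_uniq t tts.
have IE : induced H setT =2 H by move=> a b; rewrite /induced !inE.
have compE y : (y \in [set y in [set: T] | connect (induced H [set: T]) x y]) = (y \in t).
  rewrite !inE /= (eq_connect IE); apply/idP/idP.
    case/connectP=> p; elim: p x xt => [|a p IH] z zt /=; first by move=> _ ->.
    case/andP; rewrite (HE t) // => /and3P[_ aT _]; exact: IH.
  have from0 i : i < size t -> connect H (nth x t 0) (nth x t i).
    elim: i => [|i IH] it; first exact: connect0.
    apply: connect_trans (IH (ltnW it)) (connect1 _).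
    rewrite (HE t) ?mem_nth ?consecutive_nth ?eqxx // ltnW //.
  move=> yt; rewrite -(nth_index x xt) -(nth_index x yt).
  apply: (connect_trans (y := nth x t 0)); last by apply: from0; rewrite index_mem.
  by rewrite (sym_connect_sym Hsym); apply: from0; rewrite index_mem.
have ind : induces_path H [set y in [set: T] | connect (induced H [set: T]) x y] (size t).
  exists (fun i : 'I_(size t) => nth x t i); split.
    by move=> i j /eqP; rewrite nth_uniq // => /eqP/val_inj.
  split=> [y|i j]; last by rewrite (HE t) ?mem_nth // consecutive_nth.
  rewrite compE; split=> [yt|[i <-]]; last by rewrite mem_nth.
  have it : index y t < size t by rewrite index_mem.
  by exists (Ordinal it); rewrite /= nth_index.
by case/andP: (okts t tts) => /orP[] /eqP sz _; rewrite sz in ind; [left|right].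
Qed.
End TilingToFactor.

(** * Blocks with a tiling or a large independent set *)

Section BlockDichotomy.
Variables (T : finType) (e : rel T).
Hypotheses (e_sym : symmetric e) (e_irr : irreflexive e).

(** The path [v, mu y1, y1, ...] has [2 * size s + 1] vertices. Apart from [v] it uses whole edges
    of [mu], so [mu] still matches the rest of [D]. *)
Lemma tiled_long_alternating (D : {set T}) v mu s : v \in D ->
  perfect_matching e (D :\ v) mu -> path (alt_step e mu) v s -> alt_free D v mu s ->
  tiled e (2 * size s + 1) D.
Proof.
move=> vD pm ps fs; pose w s := flatten [seq [:: mu x; x] | x <- s].
have muK : involutive mu by case: pm.
have size_w : size (w s) = 2 * size s.
  by elim: (s) => //= x s' IH; rewrite -/(w s') IH; lia.
have mem_w s' y : (y \in w s') = (medge mu y \in map (medge mu) s').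
  elim: s' => //= x s' IH; rewrite -/(w s') !inE IH orbA; congr orb.
  apply/orP/eqP => [[/eqP->|/eqP->//]|/(medge_eq)[->|->]]; rewrite ?eqxx; auto.
  exact: medge_mu pm _.
have inD x : x \in s -> x \in D :\ v by apply: (alt_free_in pm fs).
have path_w s' a : path (alt_step e mu) a s' -> {subset s' <= D :\ v} -> path e a (w s').
  elim: s' a => //= x s' IH a /andP[eax ps'] sub.
  have ex : e (mu x) x by rewrite e_sym; apply: (mu_adj pm); apply: sub; apply: mem_head.
  rewrite -/(w s') ex [e a _]eax /=; apply: IH => // y ys.
  by apply: sub; rewrite inE ys orbT.
have sorted_w : sorted e (v :: w s) by apply: path_w.
have in_w y : y \in w s -> y \in D :\ v.
  rewrite mem_w => /mapP[b bs /medge_eq[->|->]]; first exact: inD.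
  by apply: (mu_in pm); apply: inD.
have uniq_w : uniq (v :: w s).
  apply/andP; split; first by apply/negP => /in_w; rewrite !inE eqxx.
  case/andP: fs => us _; elim: (s) us inD => //= x s' IH /andP[xs us] inD'.
  have xD : x \in D :\ v by apply: inD'; apply: mem_head.
  rewrite -/(w s') IH // => [|y ys]; last by apply: inD'; rewrite inE ys orbT.
  rewrite inE negb_or !mem_w (medge_mu pm) xs !andbT.
  by apply: contraTneq (mu_adj pm xD) => ->; rewrite e_irr.
pose U := [set x in v :: w s].
have UD : U \subset D.
  apply/subsetP => x; rewrite !inE => /orP[/eqP->//|/in_w]; by rewrite inE => /andP[].
have -> : D = (D :\: U) :|: U.
  by rewrite setUC -{1}(setIidPr UD) setID.
apply: tiledU.
- by rewrite -setI_eq0 setIDAC setDIl setDv setI0.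
- apply: matchable_tiled => //; apply: (matchable_sub pm).
    apply/subsetP => x; rewrite !inE negb_or => /andP[/andP[-> _] ->]; by [].
  move=> x; rewrite !inE !mem_w (medge_mu pm) !negb_or => /andP[/andP[xv ->] xD].
  by have := @mu_in _ _ _ _ _ pm x; rewrite !inE xv xD => /(_ isT)/andP[-> ->].
- by apply: tiled_path => //; rewrite /= size_w addn1 eqxx orbT.
Qed.

(** An alternating path with exactly [k] edges of [mu] yields a tiling. If there is none, there is
    no longer one either, since prefixes are alternating paths too. *)
Lemma block_dichotomy k (D : {set T}) : 1 < k -> D != set0 -> factor_critical e D ->
  tiled e (2 * k + 1) D \/
  exists I : {set T}, [/\ I \subset D, forall x y, x \in I -> y \in I -> ~~ e x y
    & 5 * (#|D :\: I| + 1) <= 6 * k ^ 2 * #|I|].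
Proof.
move=> k1 /set0Pn[v vD] crit; have [mu pm] := crit v vD.
have [/existsP[t /andP[pt ft]]|none] :=
    boolP [exists t : k.-tuple T, path (alt_step e mu) v t && alt_free D v mu t].
  by left; have := tiled_long_alternating vD pm pt ft; rewrite size_tuple.
right; apply: (short_block_independent_set e_sym e_irr vD pm crit) => // s ps fs.
rewrite ltnNge; apply/negP => ks; case/negP: none; apply/existsP.
have szt : size (take k s) == k by rewrite size_takel.
exists (Tuple szt); rewrite /= take_path //=.
exact: (alt_free_subseq (take_subseq _ _) fs).
Qed.

End BlockDichotomy.

(** * Hall's condition for the bad blocks, and the factor *)

Lemma card_disjoint_bigcup (I T : finType) (J : {set I}) (F : I -> {set T}) :
  (forall i j x, i \in J -> j \in J -> x \in F i -> x \in F j -> i = j) ->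
  #|\bigcup_(i in J) F i| = \sum_(i in J) #|F i|.
Proof.
have [n] := ubnP #|J|; elim: n J => // n IH J ltn inj.
have [->|[i iJ]] := set_0Vmem J; first by rewrite !big_set0 cards0.
rewrite (big_setD1 i) //= [RHS](big_setD1 i) //= -IH; last 2 first.
- by move: ltn; rewrite (cardsD1 i) iJ.
- by move=> j j' x /setD1P[_ jJ] /setD1P[_ j'J]; apply: inj.
rewrite cardsU (_ : _ :&: _ = set0) ?cards0 ?subn0 //; apply/setP => x; rewrite !inE.
apply: contraTF isT => /andP[xi /bigcupP[j]]; rewrite !inE => /andP[ji jJ] xj.
by rewrite (inj i j x) ?eqxx in ji.
Qed.

(** A vertex outside [X] with all its neighbours in [X] is a component of its own once [X] is
    deleted. *)
Lemma isolated_c_del (T : finType) (e : rel T) (X I : {set T}) :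
  [disjoint I & X] -> (forall x y, x \in I -> e x y -> y \in X) -> #|I| <= c_del e X 1.
Proof.
move=> dis nbr; rewrite -(card_imset _ set1_inj); apply: subset_leq_card.
apply/subsetP => C /imsetP[x xI ->]; have xX : x \notin X by rewrite (disjointFr dis).
rewrite inE cards1 eqxx andbT; apply/existsP; exists x; rewrite inE xX /=.
apply/eqP/setP => y; rewrite !inE; apply/eqP/andP => [->|[yX /connectP[[|z p] /=]]].
- by rewrite xX connect0.
- by move=> _ ->.
- by case/andP=> /and3P[_ zX /(nbr x z xI) zX']; rewrite inE zX' in zX.
Qed.

(** The sum is at least its term at j = 0, which counts isolated vertices; then denominators are
    cleared. *)
Lemma independent_expansion (k : nat) (T : finType) (e : rel T) :
  0 < k ->
  (forall X : {set T},
     (((\sum_(0 <= j < k) c_del e X (2 * j + 1))%:R : rat)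
       <= (5%:R / (6 * k ^ 2)%:R) * (#|X|%:R))%R) ->
  forall X I : {set T}, [disjoint I & X] -> (forall x y, x \in I -> e x y -> y \in X) ->
  6 * k ^ 2 * #|I| <= 5 * #|X|.
Proof.
move=> k0 hyp X I dis nbr; have := hyp X.
rewrite mulrAC ler_pdivlMr; last by rewrite ltr0n muln_gt0 expn_gt0 k0.
rewrite -!natrM ler_nat mulnC; apply: leq_trans; rewrite leq_mul2l; apply/orP; right.
by rewrite big_ltn // muln0 add0n; apply: leq_trans (isolated_c_del dis nbr) (leq_addr _ _).
Qed.

Theorem theorem1 (k : nat) (T : finType) (e : rel T) :
  3 <= k ->
  simple_graph e ->
  (forall X : {set T},
     (((\sum_(0 <= j < k) c_del e X (2 * j + 1))%:R : rat)
       <= (5%:R / (6 * k ^ 2)%:R) * (#|X|%:R))%R) ->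
  has_P2_Pm_factor e (2 * k + 1).
Proof.
move=> k3 [e_sym e_irr] /independent_expansion expand.
have {}expand := expand (ltnW (ltnW k3)).
have [A [P [dAP hA crit]]] := critical_decomposition e_sym e_irr [set: T].
case/decompositionP: (dAP) => _ partP oddP sepP.
apply: tiled_factor => //.
pose defect (D I : {set T}) := [&& I \subset D,
  [forall x in I, forall y in I, ~~ e x y] & 5 * (#|D :\: I| + 1) <= 6 * k ^ 2 * #|I|].
pose Bad := [set D : {set T} | [exists I : {set T}, defect D I]].
apply: (@decomposition_assemble _ e (tiled e (2 * k + 1)) _ A P Bad) => //.
- exact: tiled0.
- exact: tiledU.
- by move=> x y; apply: tiled2.
- by move=> D x DP xD; apply: matchable_tiled => //; apply: crit.
- move=> D DP; have D0 : D != set0 by apply: partition_neq0 partP DP.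
  have [//|[I [ID indI cardI]]] := block_dichotomy e_sym e_irr (ltnW k3) D0 (crit D DP).
  rewrite inE => /negP[]; apply/existsP; exists I; rewrite /defect ID cardI andbT.
  by apply/forall_inP => x xI; apply/forall_inP => y; apply: indI.
move=> J JP JBad; set N := [set a in A | _].
(* [set0] is a placeholder: on bad blocks the [pick] succeeds. *)
pose I0 D := odflt set0 [pick I | defect D I].
have I0P D : D \in J -> defect D (I0 D).
  move/(subsetP JBad); rewrite inE => /existsP[I dI]; rewrite /I0.
  by case: pickP => //= /(_ I); rewrite dI.
have sub D x : D \in J -> x \in I0 D -> x \in D.
  by move=> /I0P/and3P[/subsetP s _ _] /s.
have sameblock D D' x : D \in P -> D' \in P -> x \in D -> x \in D' -> D = D'.
  move=> DP D'P xD xD'; have tP := partition_trivIset partP.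
  by rewrite -(def_pblock tP DP xD) (def_pblock tP D'P xD').
(* [X] contains all neighbours of [I]: one in [A] lies in [N], any other lies in the same block and,
   by independence, outside [I0 D]. *)
pose I := \bigcup_(D in J) I0 D; pose X := N :|: \bigcup_(D in J) (D :\: I0 D).
have inj (F : {set T} -> {set T}) : (forall D, D \in J -> F D \subset D) ->
    forall D D' x, D \in J -> D' \in J -> x \in F D -> x \in F D' -> D = D'.
  move=> FD D D' x DJ D'J /(subsetP (FD D DJ)) xD /(subsetP (FD D' D'J)) xD'.
  by apply: (sameblock D D' x) => //; apply: (subsetP JP).
have cardI : #|I| = \sum_(D in J) #|I0 D|.
  apply: card_disjoint_bigcup; apply: inj => D DJ; apply/subsetP => x; exact: sub.
have cardX : #|X| <= #|N| + \sum_(D in J) #|D :\: I0 D|.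
  rewrite -(card_disjoint_bigcup (F := fun D => D :\: I0 D)); first exact: leq_card_setU.
  by apply: inj => D DJ; apply: subsetDl.
have main : 6 * k ^ 2 * #|I| <= 5 * #|X|.
  apply: expand.
    rewrite -setI_eq0; apply/eqP/setP => x; rewrite in_set0; apply/negP.
    case/setIP=> /bigcupP[D DJ xI] /setUP[|/bigcupP[D' D'J]].
      rewrite inE => /andP[xA _].
      have := subsetP (partitionS partP (subsetP JP D DJ)) x (sub D x DJ xI).
      by rewrite inE xA.
    case/setDP=> xD' xI'; case/negP: xI'.
    by rewrite -(sameblock D D' x) ?(subsetP JP) // sub.
  move=> x y /bigcupP[D DJ xI] exy; have xD := sub D x DJ xI.
  rewrite inE; have [yA|yA] := boolP (y \in A).
    rewrite inE yA; apply/orP; left; apply/existsP; exists D; rewrite DJ.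
    by apply/existsP; exists x; rewrite xD.
  have : y \in cover P by rewrite (cover_partition partP) !inE yA.
  case/bigcupP=> D' D'P yD'; have DD' := sepP D D' x y (subsetP JP D DJ) D'P xD yD' exy.
  rewrite -DD' in yD'; apply/orP; right; apply/bigcupP; exists D; rewrite // inE yD' andbT.
  case/and3P: (I0P D DJ) => _ /forall_inP/(_ x xI)/forall_inP ind _.
  by apply: contraL exy; apply: ind.
(* With s the sum of the [#|D :\: I0 D|], this gives 5 (s + [#|J|]) <= 6 k^2 [#|I|] <= 5 [#|X|] <= 5
   ([#|N|] + s), hence [#|J| <= #|N|]. *)
have : 5 * (\sum_(D in J) #|D :\: I0 D| + #|J|) <= 6 * k ^ 2 * #|I|.
  rewrite cardI -sum1_card -big_split /= !big_distrr /=; apply: leq_sum => D DJ.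
  by case/and3P: (I0P D DJ).
by move: main cardX; move: (\sum_(D in J) _) #|X| #|N| #|J| (6 * k ^ 2 * #|I|); clear; lia.
Qed.
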